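(* Let $(E_0,E_1)$ be a pair of real Banach spaces with $E_1 \hookrightarrow E_0$ (injective continuous embedding). Let $(b_n)_{n=1}^\infty\subseteq E_1$ and $\delta,\kappa>0$ be such that for all $n=1,2,\ldots$ \[ \delta \le K(2^{-n},b_n;E_0,E_1) \le J(2^{-n}, b_n;E_0,E_1) \le \kappa. \] Let $(M,\Sigma,\rho)$ be a probability space and $\varepsilon_n\colon M\to\{-1,1\}$, $n\ge 1$, i.i.d. random variables with $\rho(\varepsilon_n=\pm 1)=\tfrac12$. Then for all $(\theta,q)\in (0,1)\times [1,\infty)$ there is a constant $c=c(\theta,q,\kappa,\delta)>0$ such that for all real sequences $(\alpha_n)_{n=1}^\infty$ with $\#\{n\ge 1:\alpha_n\neq 0\}<\infty$ one has \[ \frac{1}{c} \| (\alpha_n)_{n=1}^\infty \|_{\ell_q^{(\theta)}} \le \int_M \Big\| \sum_{n=1}^\infty \alpha_n \varepsilon_n(\xi) b_n \Big\|_{(E_0,E_1)_{\theta,q}} \rho(\mathrm{d}\xi) \le \sup_{\varepsilon_n=\pm1} \Big\| \sum_{n=1}^\infty \alpha_n \varepsilon_n b_n \Big\|_{(E_0,E_1)_{\theta,q}} \le c\, \| (\alpha_n)_{n=1}^\infty \|_{\ell_q^{(\theta)}}. \]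
   Context: All Banach spaces are real. For $x\in E_0\cap E_1$ and $\lambda>0$, $J(\lambda,x;E_0,E_1):=\max\{\|x\|_{E_0},\lambda\|x\|_{E_1}\}$; for $x\in E_0+E_1$, $K(\lambda,x;E_0,E_1):=\inf\{\|x_0\|_{E_0}+\lambda\|x_1\|_{E_1}: x=x_0+x_1,\ x_i\in E_i\}$. For $(\theta,q)\in(0,1)\times[1,\infty]$, the real interpolation space $(E_0,E_1)_{\theta,q}$ consists of all $x\in E_0+E_1$ with $\|x\|_{(E_0,E_1)_{\theta,q}}:=\big\|\lambda\mapsto \lambda^{-\theta}K(\lambda,x;E_0,E_1)\big\|_{L_q((0,\infty),\mathrm{d}\lambda/\lambda)}<\infty$. For $s\in\mathbb{R}$ and $q\in[1,\infty]$, $\ell_q^{(s)}$ is the space of real sequences $x=(x_n)_{n\ge1}$ with $\|x\|_{\ell_q^{(s)}}:=\|(2^{sn}x_n)_{n=1}^\infty\|_{\ell_q}<\infty$. *)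

(* Defs.v *)
From HB Require Import structures.
From mathcomp Require Import all_boot all_order all_algebra.
From mathcomp Require Import all_classical all_reals all_analysis.
Set Implicit Arguments. Unset Strict Implicit. Unset Printing Implicit Defensive.
Import Order.TTheory GRing.Theory Num.Theory.
Import numFieldNormedType.Exports.
Local Open Scope classical_set_scope.
Local Open Scope ring_scope.

(* A couple (E0,E1) of real Banach spaces with E1 injectively and continuously
   embedded in E0 is modelled by two complete normed R-modules E0, E1 and a
   continuous injective linear map iota : E1 -> E0.  Then E0 + E1 = E0 and
   E0 \cap E1 = iota(E1) (identified with E1, with the norms of both spaces). *)

Section Interp.
Context {R : realType} {E0 E1 : normedModType R} (iota : E1 -> E0).

Definition Jfun (lam : R) (x : E1) : R := Num.max `|iota x| (lam * `|x|).

Definition Kfun (lam : R) (x : E0) : R :=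
  inf [set r : R | exists (x0 : E0) (x1 : E1),
          x = x0 + iota x1 /\ r = `|x0| + lam * `|x1|].

Definition interp_norm (theta q : R) (x : E0) : \bar R :=
  poweR (\int[lebesgue_measure]_(lam in `]0%R, +oo[%classic)
           (((lam `^ (- theta) * Kfun lam x) `^ q) / lam)%:E) q^-1.
End Interp.

Definition lq_weighted_norm {R : realType} (s q : R) (x : nat -> R) : \bar R :=
  poweR (\sum_(1 <= n <oo) (((2 : R) `^ (s * n%:R) * `|x n|) `^ q)%:E)%E q^-1.

Definition mutually_independent {d} {M : measurableType d} {R : realType}
  (P : probability M R) (X : nat -> M -> R) (I : set nat) : Prop :=
  forall (S : seq nat) (A : nat -> set R),
    uniq S -> (forall n, n \in S -> I n) -> (forall n, measurable (A n)) ->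
    P (\big[setI/setT]_(n <- S) (X n @^-1` A n)) =
    (\prod_(n <- S) P (X n @^-1` A n))%E.

Definition rademacher_seq {d} {M : measurableType d} {R : realType}
  (P : probability M R) (eps : nat -> M -> R) : Prop :=
  [/\ forall n, (0 < n)%N -> measurable_fun setT (eps n),
      forall n xi, (0 < n)%N -> eps n xi = 1 \/ eps n xi = -1,
      forall n, (0 < n)%N -> P [set xi | eps n xi = 1] = (2^-1)%:E,
      forall n, (0 < n)%N -> P [set xi | eps n xi = -1] = (2^-1)%:E &
      mutually_independent P eps [set n | (0 < n)%N]].

(* Main.v *)
(* The dyadic scale lam ~ 2^-n sees only the n-th term.  Upper bound: K(lam, b_n) <=
   kappa min(1, lam 2^n), so lam^-theta K(lam, x) is dominated by the sum of the weights
   c_n = 2^(theta n) |alpha_n| against an integrable bump centred at lam = 2^-n; this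
   kernel has bounded row sums and bounded column integrals, and Schur's test (here a
   weighted power mean inequality) gives the l_q bound.  Lower bound: averaging over
   signs kills the other terms, so the mean of K(2^-k, x) is at least |alpha_k| K(2^-k, b_k)
   >= delta |alpha_k|; testing against the l_q-dual of (c_n) transfers this from
   each scale to the l_q norm over all scales. *)
Require Import Defs.
From HB Require Import structures.
From mathcomp Require Import all_boot all_order all_algebra.
From mathcomp Require Import all_classical all_reals all_analysis.
From mathcomp Require Import measurable_realfun ring lra.
Import Order.TTheory GRing.Theory Num.Theory.
Import numFieldNormedType.Exports.
Local Open Scope classical_set_scope.
Local Open Scope ring_scope.

(** * Convexity inequalities for real powers *)

(** Young's inequality for the product u * 1 with exponents q and (1 - 1/q)^-1 is exactly this
    tangent bound; q = 1 is split off because its conjugate exponent is infinite. *)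
Lemma powR_ge_tangent {R : realType} (q u : R) :
  1 <= q -> 0 <= u -> 1 + q * (u - 1) <= u `^ q.
Proof.
rewrite le_eqVlt => /predU1P[<- u0|q1 u0]; first by rewrite powRr1//; lra.
have q0 : 0 < q by lra.
have qN0 : q != 0 by rewrite gt_eqF.
have q'0 : 0 < (1 - q^-1)^-1 by rewrite invr_gt0 subr_gt0 invf_lt1.
have := @conjugate_powR R u 1 q (1 - q^-1)^-1 u0 ler01 q0 q'0.
rewrite invrK addrCA subrr addr0 => /(_ erefl).
rewrite powR1 mulr1 mul1r -(ler_pM2l q0) mulrDr mulrCA mulfV// mulr1.
by rewrite mulrBr mulfV// mulr1; lra.
Qed.

(** Jensen's inequality with unnormalised weights: with s = A / W the weighted mean, the tangent
    bound at [y i] / s is summed against [m], and its linear terms cancel. *)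
Lemma power_mean {R : realType} (I : finType) (q : R) (m y : I -> R) :
  1 <= q -> (forall i, 0 <= m i) -> (forall i, 0 <= y i) ->
  (\sum_i m i * y i) `^ q <= (\sum_i m i) `^ (q - 1) * \sum_i m i * y i `^ q.
Proof.
move=> q1 m0 y0; have q0 : 0 < q by lra.
set W := \sum_i m i; set A := \sum_i m i * y i.
have A0 : 0 <= A by apply: sumr_ge0 => i _; apply: mulr_ge0.
have W0 : 0 <= W by apply: sumr_ge0.
have [AE|AN] := eqVneq A 0.
  rewrite AE powR0 ?gt_eqF// mulr_ge0 ?powR_ge0//.
  by apply: sumr_ge0 => i _; rewrite mulr_ge0 ?powR_ge0.
have Wgt0 : 0 < W.
  rewrite lt_neqAle W0 andbT eq_sym; apply: contra_neq AN => WE.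
  rewrite /A big1// => i _.
  suff -> : m i = 0 by rewrite mul0r.
  by apply/eqP; move: WE => /eqP; rewrite psumr_eq0// => /allP; apply; rewrite mem_index_enum.
have s0 : 0 < A / W by rewrite divr_gt0// lt_neqAle eq_sym AN.
have tangent i : m i * ((A / W) `^ q * (1 + q * (y i / (A / W) - 1)))
    <= m i * y i `^ q.
  apply: ler_wpM2l => //.
  have yE : y i = A / W * (y i / (A / W)) by rewrite mulrC divfK// gt_eqF.
  rewrite [leRHS](_ : _ = (A / W) `^ q * (y i / (A / W)) `^ q); last first.
    by rewrite -powRM -?yE// ?divr_ge0.
  by rewrite ler_wpM2l ?powR_ge0// powR_ge_tangent// !divr_ge0.
have -> : A `^ q = W `^ (q - 1) * ((A / W) `^ q * W).
  rewrite powRB ?(gt_eqF Wgt0) ?implybT// powRr1//.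
  rewrite [RHS](_ : _ = (A / W) `^ q * W `^ q); last by field; rewrite gt_eqF.
  by rewrite -powRM ?divr_ge0// divfK// gt_eqF.
rewrite ler_wpM2l ?powR_ge0//.
apply: le_trans; last by apply: ler_sum => i _; exact: tangent.
rewrite le_eqVlt; apply/orP; left; apply/eqP.
under eq_bigr => i _.
  rewrite (_ : _ * _ = (A / W) `^ q * (1 - q) * m i
    + (A / W) `^ q * q / (A / W) * (m i * y i)); last by ring.
  over.
rewrite big_split/= -!mulr_sumr -/W -/A.
by field; rewrite AN gt_eqF.
Qed.

(** * Elementary properties of the K-functional *)

Section Kfunctional.
Context {R : realType} {E0 E1 : normedModType R} (iota : {linear E1 -> E0}).
Implicit Types (lam : R) (x y : E0).

Local Notation K := (Kfun iota).

Lemma Kfun_le lam (x0 : E0) (x1 : E1) : 0 <= lam ->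
  K lam (x0 + iota x1) <= `|x0| + lam * `|x1|.
Proof.
move=> lam0; apply: ge_inf; last by exists x0, x1.
by exists 0 => _ [u [v [_ ->]]]; rewrite addr_ge0// mulr_ge0.
Qed.

Lemma le_Kfun lam x (r : R) :
  (forall (x0 : E0) (x1 : E1), x = x0 + iota x1 -> r <= `|x0| + lam * `|x1|) -> r <= K lam x.
Proof.
move=> h; apply: lb_le_inf; last by move=> _ [u [v [xE ->]]]; exact: h.
(* The trivial decomposition x + 0 shows the set nonempty, so [inf] is a genuine infimum. *)
by exists (`|x| + lam * `|0 : E1|), x, 0; rewrite raddf0 addr0.
Qed.

Lemma Kfun_ge0 lam x : 0 <= lam -> 0 <= K lam x.
Proof. by move=> lam0; apply: le_Kfun => *; rewrite addr_ge0// mulr_ge0. Qed.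

Lemma Kfun_le_norm lam x : 0 <= lam -> K lam x <= `|x|.
Proof.
by move=> /(Kfun_le _ x 0); rewrite raddf0 addr0 normr0 mulr0 addr0.
Qed.

Lemma Kfun_iota_le lam (z : E1) : 0 <= lam -> K lam (iota z) <= lam * `|z|.
Proof. by move=> /(Kfun_le _ 0 z); rewrite normr0 !add0r. Qed.

(** Monotonicity serves twice: for the measurability of the integrand in [lam], and to let the
    single value at 2^-n control a whole dyadic interval. *)
Lemma Kfun_homo x lam mu : 0 <= lam -> lam <= mu -> K lam x <= K mu x.
Proof.
move=> lam0 lm; apply: le_Kfun => x0 x1 ->; apply: (le_trans (Kfun_le _ _ _ lam0)).
by rewrite lerD2l ler_wpM2r.
Qed.

Lemma KfunD lam x y : 0 <= lam -> K lam (x + y) <= K lam x + K lam y.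
Proof.
move=> lam0; rewrite -lerBlDr; apply: le_Kfun => x0 x1 ->.
rewrite lerBlDr [_ + K lam y]addrC -lerBlDr; apply: le_Kfun => y0 y1 ->.
rewrite lerBlDr addrACA -raddfD; apply: (le_trans (Kfun_le _ _ _ lam0)).
rewrite [leRHS]addrACA -mulrDr [`|y1| + _]addrC [`|y0| + _]addrC.
by rewrite lerD ?ler_wpM2l ?ler_normD.
Qed.

Lemma KfunZ_le lam (a : R) x : 0 <= lam -> K lam (a *: x) <= `|a| * K lam x.
Proof.
move=> lam0; have [->|a0] := eqVneq a 0.
  by rewrite scale0r normr0 mul0r (le_trans (Kfun_le_norm _ _ lam0))// normr0.
rewrite -ler_pdivrMl ?normr_gt0//; apply: le_Kfun => x0 x1 ->.
rewrite ler_pdivrMl ?normr_gt0// scalerDr -linearZ.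
apply: (le_trans (Kfun_le _ _ _ lam0)).
by rewrite !normrZ mulrDr mulrCA.
Qed.

Lemma KfunZ lam (a : R) x : 0 <= lam -> K lam (a *: x) = `|a| * K lam x.
Proof.
move=> lam0; apply/eqP; rewrite eq_le KfunZ_le//=.
have [->|a0] := eqVneq a 0; first by rewrite normr0 mul0r Kfun_ge0.
have := KfunZ_le lam a^-1 (a *: x) lam0.
by rewrite scalerA mulVf// scale1r normfV ler_pdivlMl ?normr_gt0.
Qed.

Lemma Kfun_sum lam (I : finType) (x : I -> E0) : 0 <= lam ->
  K lam (\sum_i x i) <= \sum_i K lam (x i).
Proof.
move=> lam0; apply: (big_ind2 (fun u v => K lam u <= v)) => //.
  by rewrite (le_trans (Kfun_le_norm _ _ lam0))// normr0.
by move=> u v s t uv st; rewrite (le_trans (KfunD _ _ _ lam0))// lerD.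
Qed.

End Kfunctional.

(** * Averages over random signs *)

(** The first N signs cut [M] into 2^N cells of probability 2^-N, by independence. On each cell [F]
    is constant, so it is a simple function and its measurability need not be assumed. The boolean
    [true] encodes the sign -1. *)
Lemma rademacher_integral {d} {M : measurableType d} {R : realType}
    (rho : probability M R) (eps : nat -> M -> R) (N : nat)
    (f : {ffun 'I_N -> bool} -> R) (F : M -> \bar R) :
  rademacher_seq rho eps -> (forall e, 0 <= f e) ->
  (forall (e : {ffun 'I_N -> bool}) xi, (forall i : 'I_N, eps i.+1 xi = (-1) ^+ e i) -> F xi = (f e)%:E) ->
  (\int[rho]_xi F xi = (2 ^- N * \sum_e f e)%R%:E)%E.
Proof.
move=> [meps epsV P1 PN1 indep] f0 Ff.
(* Independence is stated for families indexed by all of nat, so the singletons are extended by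
   [setT]. The value at n = 0 is junk: only indices [i.+1] are used. *)
pose A (e : {ffun 'I_N -> bool}) n : set R :=
  if insub n.-1 is Some i then [set (-1) ^+ e i] else setT.
pose D (e : {ffun 'I_N -> bool}) := \big[setI/setT]_(i < N) (eps i.+1 @^-1` A e i.+1).
have AE e (i : 'I_N) : A e i.+1 = [set (-1) ^+ e i].
  by rewrite /A /= insubT//= => lt; congr [set (-1) ^+ e _]; exact: val_inj.
have DE (e : {ffun 'I_N -> bool}) xi : D e xi <-> forall i : 'I_N, eps i.+1 xi = (-1) ^+ e i.
  rewrite /D -bigcap_seq; split => [h i|h i _]; last by rewrite /= AE.
  by have := h i; rewrite /= AE; apply; rewrite mem_index_enum.
have mA e n : measurable (A e n) by rewrite /A; case: insubP.
have mD e : measurable (D e).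
  apply: bigsetI_measurable => i _; rewrite -[_ @^-1` _]setTI.
  exact: meps.
have PD e : rho (D e) = (2 ^- N)%:E.
  have := indep [seq (val i).+1 | i <- index_enum 'I_N] (A e).
  rewrite !big_map -/(D e) => ->//.
  - rewrite (eq_bigr (fun=> (2^-1 : R)%:E)) => [|i _].
      by rewrite prodEFin big_const_ord iter_mulr_1 exprVn.
    rewrite AE; case: (e i); [exact: PN1|exact: P1].
  - by rewrite map_inj_uniq ?index_enum_uniq// => i j [] /val_inj.
  - by move=> n /mapP[i _ ->].
have FE xi : F xi = (\sum_e (f e * \1_(D e) xi)%:E)%E.
  pose e0 := [ffun i : 'I_N => eps i.+1 xi == -1].
  have e0P : forall i : 'I_N, eps i.+1 xi = (-1) ^+ e0 i.
    move=> i; rewrite ffunE; case: eqP => [->|]; first by rewrite expr1.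
    by case: (epsV i.+1 xi isT) => [->|->].
  rewrite (bigD1 e0)//= big1 ?adde0 => [|e ee0].
    rewrite (Ff _ _ e0P) indicE mem_set ?mulr1//; exact/DE.
  rewrite indicE memNset ?mulr0// => /DE eP.
  case/eqP: ee0; apply/ffunP => i; have := e0P i; rewrite eP.
  by case: (e i); case: (e0 i); rewrite ?expr0 ?expr1 => // h; exfalso; lra.
under eq_integral do rewrite FE.
rewrite ge0_integral_sum//; last 2 first.
- by move=> e; apply/measurable_EFinP; apply: measurable_funM.
- by move=> e xi _; rewrite lee_fin mulr_ge0.
rewrite mulr_sumr -sumEFin; apply: eq_bigr => e _.
under eq_integral do rewrite EFinM.
rewrite ge0_integralZl_EFin//.
- rewrite integral_indic// setIT mulrC EFinM; congr (_ * _)%E; exact: PD.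
- by apply/measurable_EFinP.
Qed.

Definition flip_sign {N} (k : 'I_N) (e : {ffun 'I_N -> bool}) : {ffun 'I_N -> bool} :=
  [ffun i => (i == k) (+) e i].

Lemma flip_signK {N} (k : 'I_N) : involutive (flip_sign k).
Proof. by move=> e; apply/ffunP => i; rewrite !ffunE addKb. Qed.

(* Pair each sign pattern with the one flipped at k: by the triangle inequality the two
   values of p add up to at least p (2 v k). *)
Lemma sum_seminorm_signs {R : realType} {V : lmodType R} (p : V -> R) (N : nat)
    (v : 'I_N -> V) (k : 'I_N) :
  (forall x y, p (x + y) <= p x + p y) -> (forall a x, p (a *: x) = `|a| * p x) ->
  2 ^+ N * p (v k) <= \sum_(e : {ffun 'I_N -> bool}) p (\sum_i (-1) ^+ e i *: v i).
Proof.
move=> pD pZ; pose X (e : {ffun 'I_N -> bool}) := \sum_i (-1) ^+ e i *: v i.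
rewrite -/(X _); have pN x : p (- x) = p x by rewrite -scaleN1r pZ normrN1 mul1r.
have diff e : X e - X (flip_sign k e) = (2 * (-1) ^+ e k) *: v k.
  rewrite /X -sumrB (bigD1 k)//= big1 => [|i ik].
    rewrite addr0 ffunE eqxx -scalerBl; congr (_ *: _).
    by case: (e k) => /=; rewrite ?expr1 ?expr0; lra.
  by rewrite ffunE (negPf ik) subrr.
rewrite -(ler_pM2l (ltr0n R 2)).
have -> : 2 * (\sum_e p (X e)) = \sum_e (p (X e) + p (X (flip_sign k e))).
  rewrite big_split/= mulr_natl mulr2n; congr (_ + _).
  by rewrite [LHS](reindex_inj (inv_inj (flip_signK k))).
apply: (@le_trans _ _ (\sum_(e : {ffun 'I_N -> bool}) (2 * p (v k)))).
  rewrite sumr_const card_ffun card_bool card_ord -[leRHS]mulr_natl natrX.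
  by rewrite mulrCA.
apply: ler_sum => e _; rewrite -[X in _ + X]pN; apply: le_trans (pD _ _).
by rewrite diff pZ normrM normrX normrN1 expr1n mulr1 ger0_norm.
Qed.

(** * The bump kernel: row sums and column integrals *)

(* t G'(t) / eta for G(t) = t^eta / (1 + t^eta). *)
Definition logistic_bump {R : realType} (eta t : R) : R := t `^ eta / (1 + t `^ eta) ^+ 2.

Lemma logistic_bump_ge0 {R : realType} (eta t : R) : 0 <= logistic_bump eta t.
Proof. by rewrite divr_ge0 ?powR_ge0// exprn_ge0// addr_ge0 ?powR_ge0. Qed.

(** With y = t^eta the left side is at most min(y, 1/y), since [eta] is below both decay rates
    [theta] and 1 - [theta]. The factor 4 comes from (1 + y)^2 <= 4 max(1, y)^2. *)
Lemma min_powR_le_bump {R : realType} (theta eta t : R) :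
  0 <= eta -> eta <= theta -> eta <= 1 - theta -> 0 < t ->
  t `^ (- theta) * Num.min 1 t <= 4 * logistic_bump eta t.
Proof.
move=> eta0 et e1t t0; rewrite /logistic_bump.
have y0 : 0 < t `^ eta by rewrite powR_gt0.
have [t1|t1] := leP 1 t.
  rewrite mulr1; apply: (@le_trans _ _ (t `^ eta)^-1).
    by rewrite -powRN ler_powR// lerN2.
  have y1 : 1 <= t `^ eta by rewrite -(powRr0 t) ler_powR.
  rewrite mulrA ler_pdivlMr ?exprn_gt0 ?addr_gt0// ler_pdivrMl//.
  by nra.
rewrite -{2}(powRr1 (ltW t0)) -powRD ?(gt_eqF t0) ?implybT// addrC.
apply: (@le_trans _ _ (t `^ eta)); first by rewrite ger_powR// t0 ltW.
have y1 : t `^ eta <= 1 by rewrite -(powRr0 t) ger_powR// t0 ltW.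
rewrite mulrA ler_pdivlMr ?exprn_gt0 ?addr_gt0// mulrC ler_pM2r//.
by nra.
Qed.

(* With G = t^eta / (1 + t^eta), the bump at t is at most w / (w - 1) times the increment
   of G when t doubles, where w = 2^eta; the increments telescope. *)
Lemma sum_bump_le {R : realType} (eta lam : R) (N : nat) : 0 < eta -> 0 < lam ->
  \sum_(i < N) logistic_bump eta (lam * 2 ^+ i.+1) <= 2 `^ eta / (2 `^ eta - 1).
Proof.
move=> eta0 lam0; set w := 2 `^ eta.
have w1 : 1 < w.
  have : 1 `^ eta < w by rewrite gt0_ltr_powR// ?nnegrE// ltr1n.
  by rewrite powR1.
pose y i := (lam * 2 ^+ i) `^ eta.
have y0 i : 0 < y i by rewrite powR_gt0// mulr_gt0// exprn_gt0.
have yS i : y i.+1 = w * y i.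
  by rewrite /y exprS mulrCA [LHS]powRM// mulr_ge0 ?exprn_ge0 ?(ltW lam0).
pose G i := y i / (1 + y i).
have step i : logistic_bump eta (lam * 2 ^+ i) <= w / (w - 1) * (G i.+1 - G i).
  rewrite /logistic_bump -/(y i) /G yS; have := y0 i; move: (y i) => z z0.
  have -> : w / (w - 1) * (w * z / (1 + w * z) - z / (1 + z)) =
    w * z / ((1 + z) * (1 + w * z)).
    by field; rewrite !gt_eqF//; nra.
  rewrite ler_pdivrMr ?exprn_gt0//; last nra.
  rewrite mulrAC ler_pdivlMr; last nra.
  have : 0 <= z * (1 + z) * (w - 1) by rewrite !mulr_ge0//; lra.
  by nra.
apply: (@le_trans _ _ (\sum_(i < N) w / (w - 1) * (G i.+2 - G i.+1))).
  by apply: ler_sum => i _; exact: step.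
rewrite -mulr_sumr -{2}[w / (w - 1)]mulr1 ler_wpM2l//.
  by rewrite divr_ge0//; lra.
rewrite -(big_mkord xpredT (fun i => G i.+2 - G i.+1)) telescope_sumr//.
have G1 : 0 <= G 1%N by rewrite divr_ge0 ?addr_ge0 ?ltW.
have GN : G N.+1 <= 1.
  by rewrite ler_pdivrMr ?mul1r ?lerDr// addr_gt0.
by rewrite lerBlDr (le_trans GN)// lerDl.
Qed.

Lemma is_derive1_powR {R : realType} (eta x : R) : 0 < x ->
  is_derive x 1 (@powR R ^~ eta) (eta * x `^ (eta - 1)).
Proof.
move=> x0; have xI : x \in `]0, +oo[%R by rewrite in_itv/= x0.
by apply: DeriveDef; [exact: derivable_powR|rewrite -derive1E powR_derive1].
Qed.

(** This is G(r x) / eta - 1 / eta, with G = t^eta / (1 + t^eta). Keeping r^eta as a separate factor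
    lets the power rule in x apply directly. *)
Definition bump_primitive {R : realType} (eta r x : R) : R :=
  - eta^-1 * (1 + r `^ eta * x `^ eta)^-1.

Lemma is_derive_bump_primitive {R : realType} (eta r x : R) :
  0 < eta -> 0 < r -> 0 < x ->
  is_derive x 1 (bump_primitive eta r) (logistic_bump eta (x * r) / x).
Proof.
move=> eta0 r0 x0; have dx := is_derive1_powR eta x x0.
have y0 : 0 < 1 + r `^ eta * x `^ eta by rewrite addr_gt0// mulr_gt0// powR_gt0.
pose f : R -> R := cst 1 + (r `^ eta \*: (@powR R ^~ eta)).
have df : is_derive x 1 f (0 + r `^ eta *: (eta * x `^ (eta - 1))).
  exact: is_deriveD.
have dfV := is_deriveZ (- eta^-1) (is_deriveV (lt0r_neq0 y0 : f x != 0) df).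
apply: is_derive_eq dfV _; rewrite /logistic_bump powRM ?ltW//.
rewrite powRB ?(gt_eqF x0) ?implybT// powRr1 ?ltW// add0r.
have -> : f x = 1 + r `^ eta * x `^ eta by [].
rewrite /GRing.scale/=; field.
by rewrite [x `^ eta * _]mulrC !gt_eqF.
Qed.

Lemma measurable_fun_bump {R : realType} (eta r : R) : 0 < eta -> 0 < r ->
  measurable_fun (`]0, +oo[ : set R) (fun x : R => logistic_bump eta (x * r) / x).
Proof.
move=> eta0 r0; apply: (eq_measurable_fun
  (fun x : R => logistic_bump eta (x * r) * x `^ (-1))).
  by move=> x; rewrite inE/= in_itv/= andbT => x0; rewrite powR_inv1 ?ltW.
apply: measurable_funTS; apply: measurable_funM; last exact: measurable_powR.
rewrite /logistic_bump.
have mp : measurable_fun setT (fun x : R => (x * r) `^ eta).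
  rewrite (_ : (fun x => _) = (@powR R ^~ eta) \o (fun x => x * r))//.
  apply: measurableT_comp; [exact: measurable_powR|exact: measurable_funM].
rewrite (_ : (fun x => _) = (fun x => (x * r) `^ eta *
    ((@powR R ^~ (- 2)) \o (fun x => 1 + (x * r) `^ eta)) x)); last first.
  by apply/funext => x /=; rewrite powR_invn// addr_ge0 ?powR_ge0.
apply: measurable_funM => //; apply: measurableT_comp; first exact: measurable_powR.
exact: measurable_funD.
Qed.

(** The primitive takes values in [-1/eta, 0], so its increment is at most 1/eta, uniformly in the
    interval and in [r]. *)
Lemma integral_bump_itv_le {R : realType} (eta r a b : R) :
  0 < eta -> 0 < r -> 0 < a -> a < b ->
  (\int[lebesgue_measure]_(x in `[a, b]) (logistic_bump eta (x * r) / x)%:E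
    <= (eta^-1)%:E)%E.
Proof.
move=> eta0 r0 a0 ab; pose F := bump_primitive eta r.
have dF (x : R) : 0 < x -> is_derive x 1 F (logistic_bump eta (x * r) / x).
  exact: is_derive_bump_primitive.
have cF (x : R) : 0 < x -> {for x, continuous F}.
  move=> x0; apply: differentiable_continuous; apply/derivable1_diffP.
  by have [] := dF x x0.
have cf (x : R) : 0 < x -> {for x, continuous (fun x : R => logistic_bump eta (x * r) / x)}.
  move=> x0; have xr0 : 0 < x * r by rewrite mulr_gt0.
  have cp : {for x * r, continuous (@powR R ^~ eta)}.
    apply: differentiable_continuous; apply/derivable1_diffP.
    by have [] := is_derive1_powR eta _ xr0.
  have c1 : (y * r) `^ eta @[y --> (x : R)] --> (x * r) `^ eta.
    apply: (continuous_cvg (f := fun y : R => y * r) _ cp).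
    by apply: cvgM; [exact: cvg_id|exact: cvg_cst].
  have c2 : 1 + (y * r) `^ eta @[y --> x] --> 1 + (x * r) `^ eta.
    by apply: cvgD => //; exact: cvg_cst.
  apply: cvgM; last by apply: cvgV; [rewrite gt_eqF|exact: cvg_id].
  apply: cvgM => //; apply: cvgV; first by rewrite expf_neq0// gt_eqF// ltr_pwDl ?powR_ge0.
  exact: cvgM.
rewrite (@continuous_FTC2 _ _ F)//.
- rewrite -EFinB lee_fin /F /bump_primitive !mulNr opprK.
  have V01 c : 0 < c -> 0 <= eta^-1 * (1 + r `^ eta * c `^ eta)^-1 <= eta^-1.
    move=> c0; rewrite mulr_ge0 ?invr_ge0 ?addr_ge0 ?mulr_ge0 ?powR_ge0 ?(ltW eta0)//=.
    rewrite ler_piMr ?invr_ge0 ?(ltW eta0)// invf_le1 ?lerDl ?mulr_ge0 ?powR_ge0//.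
    by rewrite ltr_pwDl// mulr_ge0 ?powR_ge0.
  have /andP[Va _] := V01 b (lt_trans a0 ab); have /andP[_ Vb] := V01 a a0.
  by rewrite addrC lerBlDr (le_trans Vb)// lerDl.
- apply: continuous_in_subspaceT => x.
  rewrite inE/= in_itv/= => /andP[ax _]; apply: cf; exact: lt_le_trans ax.
- split.
  + move=> x; rewrite in_itv/= => /andP[ax _].
    by have [] := dF x (lt_trans a0 ax).
  + exact/cvg_at_right_filter/cF.
  + exact/cvg_at_left_filter/cF/(lt_trans a0).
- move=> x; rewrite in_itv/= => /andP[ax _].
  by rewrite derive1E; have [_ ->] := dF x (lt_trans a0 ax).
Qed.

Lemma integral_bump_le {R : realType} (eta r : R) : 0 < eta -> 0 < r ->
  (\int[lebesgue_measure]_(x in `]0%R, +oo[) (logistic_bump eta (x * r) / x)%:E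
    <= (eta^-1)%:E)%E.
Proof.
(* Monotone exhaustion of the half-line. Starting at 2 rather than 1 keeps the endpoints distinct,
   as the bound on [a, b] requires. *)
move=> eta0 r0; pose F n : set R := `[(n.+2%:R)^-1, n.+2%:R]%classic.
have FI : \bigcup_n F n = `]0%R, +oo[%classic.
  apply/seteqP; split=> [x [n _]|x]; rewrite /F /= !in_itv/= ?andbT.
    by move=> /andP[+ _]; apply: lt_le_trans; rewrite invr_gt0.
  (* An integer above x + 1/x exceeds both x and 1/x. *)
  move=> x0; exists (Num.truncn (x + x^-1)) => //=; rewrite in_itv/=.
  have := truncnS_gt (x + x^-1); set m := Num.truncn _ => xm.
  have {}xm : x + x^-1 <= m.+2%:R.
    by apply: ltW; apply: (lt_trans xm); rewrite ltr_nat.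
  have V0 : 0 < x^-1 by rewrite invr_gt0.
  rewrite invf_ple ?posrE// -[leLHS]add0r (le_trans _ xm) ?lerD2r ?(ltW x0)//=.
  by rewrite (le_trans _ xm)// lerDl ltW.
have F0 n x : F n x -> 0 < x.
  by rewrite /F/= in_itv/= => /andP[+ _]; apply: lt_le_trans; rewrite invr_gt0.
pose f (x : R) := (logistic_bump eta (x * r) / x)%:E.
have mf : measurable_fun (`]0, +oo[ : set R) f.
  by apply/measurable_EFinP; exact: measurable_fun_bump.
have cvgI : (\int[lebesgue_measure]_(x in F n) f x)%E @[n --> \oo] -->
    (\int[lebesgue_measure]_(x in \bigcup_n F n) f x)%E.
  apply: ge0_nondecreasing_set_cvg_integral.
  - move=> m n mn; apply/subsetPset => x.
    rewrite /F/= !in_itv/= => /andP[mx xm]; apply/andP; split.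
      by apply: le_trans mx; rewrite lef_pV2 ?posrE// ler_nat !ltnS.
    by apply: (le_trans xm); rewrite ler_nat !ltnS.
  - by move=> n; apply: measurable_itv.
  - by move=> n; apply: measurable_funS mf => // x /F0; rewrite /= in_itv/= andbT.
  - by move=> n x /F0 x0; rewrite lee_fin divr_ge0 ?logistic_bump_ge0// ltW.
rewrite -FI -(cvg_lim _ cvgI)//; apply: lime_le; first exact: cvgP cvgI.
apply: nearW => n; apply: integral_bump_itv_le; rewrite ?invr_gt0//.
by rewrite (@lt_le_trans _ _ 1)// ?invf_lt1 ?ltr1n ?ler1n.
Qed.

(** * The interpolation norm and its dyadic lower bound *)

Section InterpolationNorm.
Context {R : realType} {E0 E1 : normedModType R} (iota : {linear E1 -> E0}).
Context (theta q : R) (q1 : 1 <= q).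
Let q0 : 0 < q. Proof. exact: lt_le_trans ltr01 q1. Qed.

Local Notation f x lam := (((lam `^ (- theta) * Kfun iota lam x) `^ q) / lam).

Lemma interp_integrand_ge0 x lam : 0 < lam -> 0 <= f x lam.
Proof. by move=> lam0; rewrite divr_ge0 ?powR_ge0// ltW. Qed.

Lemma measurable_interp_integrand x :
  measurable_fun (`]0, +oo[ : set R) (fun lam => f x lam).
Proof.
(* The K-functional is monotone only for [lam] >= 0; replacing [lam] by max(0, [lam]) gives a
   nondecreasing, hence measurable, function on the whole line. *)
apply: (eq_measurable_fun (fun lam : R =>
  (@powR R ^~ q \o (fun lam => lam `^ (- theta) * Kfun iota (Num.max 0 lam) x)) lam
    * lam `^ (- 1))).
  move=> lam; rewrite inE/= in_itv/= andbT => lam0.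
  by rewrite powR_inv1 ?ltW// max_r// ltW.
apply: measurable_funTS; apply: measurable_funM; last exact: measurable_powR.
apply: measurableT_comp; first exact: measurable_powR.
apply: measurable_funM; first exact: measurable_powR.
apply: nondecreasing_measurable => // s t st; apply: Kfun_homo.
  by rewrite le_max lexx.
by rewrite ge_max !le_max lexx/= st orbT.
Qed.

Lemma interp_norm_le x (V : R) : 0 <= V ->
  (\int[lebesgue_measure]_(lam in `]0%R, +oo[) (f x lam)%:E <= V%:E)%E ->
  (interp_norm iota theta q x <= (V `^ q^-1)%:E)%E.
Proof.
move=> V0 h; rewrite /interp_norm -poweR_EFin gt0_ler_poweR//.
- by rewrite invr_ge0 ltW.
- rewrite in_itv/= leey andbT; apply: integral_ge0 => lam /=.
  by rewrite in_itv/= andbT => lam0; rewrite lee_fin interp_integrand_ge0.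
- by rewrite in_itv/= leey andbT.
Qed.

Lemma interp_norm_ge x (V : R) : 0 <= V ->
  (V%:E <= \int[lebesgue_measure]_(lam in `]0%R, +oo[) (f x lam)%:E)%E ->
  ((V `^ q^-1)%:E <= interp_norm iota theta q x)%E.
Proof.
move=> V0 h; rewrite /interp_norm -poweR_EFin gt0_ler_poweR//.
- by rewrite invr_ge0 ltW.
- by rewrite in_itv/= leey andbT.
- rewrite in_itv/= leey andbT; apply: integral_ge0 => lam /=.
  by rewrite in_itv/= andbT => lam0; rewrite lee_fin interp_integrand_ge0.
Qed.

Lemma interp_norm_ge0 x : (0 <= interp_norm iota theta q x)%E.
Proof. exact: poweR_ge0. Qed.

(** The integrand is minorised by a step function on the intervals [2^-(i+1), 2^-i). There K is at
    least its value at the left endpoint, while lam^-theta and 1/lam are estimated at the right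
    endpoint; the former costs the factor 2^-theta. *)
Lemma interp_norm_ge_dyadic x (N : nat) : 0 <= theta ->
  ((2 `^ (- theta) * 2^-1 `^ q^-1 *
   (\sum_(i < N) ((2 ^+ i.+1) `^ theta * Kfun iota (2 ^- i.+1) x) `^ q) `^ q^-1)%:E
   <= interp_norm iota theta q x)%E.
Proof.
move=> theta0.
pose I (i : nat) : set R := `[2 ^- i.+1, 2 ^- i[%classic.
pose y (i : nat) := (2 ^+ i.+1) `^ theta * Kfun iota (2 ^- i.+1) x.
(* The factor 2^i bounds 1/lam from below; times the interval length 2^-(i+1) it leaves the 1/2 of
   the constant. *)
pose c (i : nat) := (2 `^ (- theta) * y i) `^ q * 2 ^+ i.
have V0 n : 0 < 2 ^- n :> R by rewrite invr_gt0 exprn_gt0.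
have y0 i : 0 <= y i by rewrite mulr_ge0 ?powR_ge0 ?Kfun_ge0 ?ltW.
have c0 i : 0 <= c i by rewrite mulr_ge0 ?powR_ge0 ?exprn_ge0.
have ymean : (2 `^ (- theta) * 2^-1 `^ q^-1 * (\sum_(i < N) y i `^ q) `^ q^-1)
   = (\sum_(i < N) (2 `^ (- theta) * y i) `^ q / 2) `^ q^-1.
  under [in RHS]eq_bigr do rewrite powRM ?powR_ge0// -mulrA [_ / 2]mulrC mulrA.
  have s0 : 0 <= \sum_(i < N) y i `^ q by apply: sumr_ge0 => i _; exact: powR_ge0.
  rewrite -mulr_sumr powRM//.
  by rewrite powRM ?powR_ge0// -powRrM mulfV ?gt_eqF// powRr1 ?powR_ge0.
rewrite ymean; apply: interp_norm_ge.
  by apply: sumr_ge0 => i _; rewrite mulr_ge0 ?powR_ge0.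
have -> : (\sum_(i < N) (2 `^ (- theta) * y i) `^ q / 2)%:E =
    (\int[lebesgue_measure]_(lam in `]0%R, +oo[) \sum_(i < N) (c i * \1_(I i) lam)%:E)%E.
  rewrite ge0_integral_sum//; last 2 first.
  - move=> i; apply/measurable_EFinP; apply: measurable_funM => //.
    by apply: measurable_indic; exact: measurable_itv.
  - by move=> i lam _; rewrite lee_fin mulr_ge0.
  rewrite -sumEFin; apply: eq_bigr => i _.
  under eq_integral do rewrite EFinM.
  rewrite ge0_integralZl_EFin//; last first.
    by apply/measurable_EFinP; apply: measurable_indic; exact: measurable_itv.
  rewrite integral_indic//; last exact: measurable_itv.
  rewrite setIidl; last first.
    move=> lam /=; rewrite !in_itv/= andbT => /andP[]; rewrite bnd_simp => lo _.
    exact: lt_le_trans lo.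
  have mI : lebesgue_measure (I i) = (2 ^- i.+1)%:E.
    rewrite /I lebesgue_measure_itv/= lte_fin ltf_pV2 ?posrE ?exprn_gt0//.
    rewrite ltr_eXn2l ?ltr1n// ltnS leqnn -EFinB; congr EFin; rewrite exprS.
    by field; rewrite expf_neq0.
  transitivity ((c i)%:E * (2 ^- i.+1)%:E)%E; last by congr (_ * _)%E.
  rewrite -EFinM /c; congr EFin; rewrite exprS.
  by field; rewrite expf_neq0.
apply: ge0_le_integral => //.
- by move=> lam _; apply: sume_ge0 => i _; rewrite lee_fin mulr_ge0.
- apply: emeasurable_sum => i; apply/measurable_EFinP; apply: measurable_funM => //.
  by apply: measurable_indic; exact: measurable_itv.
- by apply/measurable_EFinP; exact: measurable_interp_integrand.
move=> lam /=; rewrite in_itv/= andbT => lam0.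
rewrite sumEFin lee_fin.
(* The intervals are disjoint, so at most one term of the step function survives at [lam]. *)
have [[i iI]|noI] := pselect (exists i : 'I_N, I i lam); last first.
  rewrite big1 ?interp_integrand_ge0// => i _.
  by rewrite indicE memNset ?mulr0// => iI; apply: noI; exists i.
rewrite (bigD1 i)//= big1 => [|j ji].
  rewrite addr0 indicE mem_set// mulr1.
  move: iI; rewrite /I /= in_itv/= => /andP[le1 le2].
  rewrite ler_pM ?powR_ge0 ?exprn_ge0//; last first.
    by rewrite -[leLHS]invrK lef_pV2 ?posrE// ltW.
  rewrite ge0_ler_powR ?nnegrE ?(ltW q0) ?mulr_ge0 ?powR_ge0 ?Kfun_ge0 ?(ltW lam0)//.
  rewrite /y mulrA ler_pM ?mulr_ge0 ?powR_ge0 ?Kfun_ge0 ?(ltW (V0 _))//; last first.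
    by apply: Kfun_homo => //; exact: ltW.
  rewrite !powRN exprS powRM ?exprn_ge0// mulrA mulVf ?gt_eqF ?powR_gt0// mul1r.
  rewrite -[leLHS]invrK lef_pV2 ?posrE ?invr_gt0 ?powR_gt0 ?exprn_gt0//.
  rewrite -powR_inv1 ?powR_ge0// powRAC powR_inv1 ?exprn_ge0//.
  by rewrite ge0_ler_powR ?nnegrE ?(ltW lam0) ?(ltW (V0 _)) ?(ltW le2).
rewrite indicE memNset ?mulr0// /I/= in_itv/= => /andP[jl lj].
move: iI; rewrite /I/= in_itv/= => /andP[il li].
have lt2 m n : 2 ^- m.+1 <= lam -> lam < 2 ^- n -> (n <= m)%N.
  move=> ml ln; have := le_lt_trans ml ln.
  by rewrite ltf_pV2 ?posrE ?exprn_gt0// ltr_eXn2l ?ltr1n.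
by case/eqP: ji; apply/val_inj/eqP; rewrite eqn_leq !lt2.
Qed.

End InterpolationNorm.

(** * Finite l_q norms and duality *)

Definition lq_norm {R : realType} {I : finType} (q : R) (c : I -> R) : R :=
  (\sum_i c i `^ q) `^ q^-1.

Lemma lq_norm_ge0 {R : realType} {I : finType} (q : R) (c : I -> R) :
  0 <= lq_norm q c.
Proof. exact: powR_ge0. Qed.

Lemma lq_norm_powR {R : realType} {I : finType} (q : R) (c : I -> R) :
  0 < q -> lq_norm q c `^ q = \sum_i c i `^ q.
Proof.
move=> q0; rewrite /lq_norm -powRrM mulVf ?gt_eqF// powRr1//.
by apply: sumr_ge0 => i _; exact: powR_ge0.
Qed.

(* Where c i = 0 the junk value y i / 0 = 0 is killed by the factor c i `^ q. *)
Lemma lq_norm_dual {R : realType} {I : finType} (q : R) (c y : I -> R) :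
  1 <= q -> (forall i, 0 <= c i) -> (forall i, 0 <= y i) ->
  \sum_i c i `^ q * (y i / c i) <= lq_norm q c `^ (q - 1) * lq_norm q y.
Proof.
move=> q1 c0 y0; have q0 : 0 < q by lra.
have s0 : 0 <= \sum_i c i `^ q * (y i / c i).
  by apply: sumr_ge0 => i _; rewrite mulr_ge0 ?powR_ge0 ?divr_ge0.
have r0 : 0 <= lq_norm q c `^ (q - 1) * lq_norm q y.
  by rewrite mulr_ge0 ?powR_ge0.
have : (\sum_i c i `^ q * (y i / c i)) `^ q <=
    (lq_norm q c `^ (q - 1) * lq_norm q y) `^ q.
  rewrite powRM ?powR_ge0// powRAC !lq_norm_powR//.
  (* Hölder's inequality, obtained as a power mean with weights c^q and values y / c. *)
  apply: le_trans (power_mean I q _ _ q1 _ _) _ => [i|i|].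
  - exact: powR_ge0.
  - exact: divr_ge0.
  rewrite ler_wpM2l ?powR_ge0//; apply: ler_sum => i _.
  rewrite -powRM ?divr_ge0//.
  have [->|ci] := eqVneq (c i) 0; first by rewrite mul0r powR0 ?gt_eqF ?powR_ge0.
  by rewrite mulrC divfK.
have powK (x : R) : 0 <= x -> (x `^ q) `^ q^-1 = x.
  by move=> x0; rewrite -powRrM mulfV ?gt_eqF// powRr1.
move=> le_q; rewrite -[leLHS]powK// -[leRHS]powK//.
by rewrite ge0_ler_powR ?nnegrE ?powR_ge0 ?invr_ge0 ?(ltW q0).
Qed.

(** Pair the pointwise hypothesis with the dual vector c^(q-1), then apply [lq_norm_dual] to each
    [y j]: the common factor [lq_norm q c]^(q-1) cancels. *)
Lemma lq_norm_sum_ge {R : realType} {I J : finType} (q w : R) (c : I -> R)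
    (y : J -> I -> R) :
  1 <= q -> 0 <= w -> (forall i, 0 <= c i) -> (forall j i, 0 <= y j i) ->
  (forall i, w * c i <= \sum_j y j i) ->
  w * lq_norm q c <= \sum_j lq_norm q (y j).
Proof.
move=> q1 w0 c0 y0 h; have q0 : 0 < q by lra.
have [->|B0] := eqVneq (lq_norm q c) 0.
  by rewrite mulr0; apply: sumr_ge0 => j _; exact: lq_norm_ge0.
have Bgt0 : 0 < lq_norm q c by rewrite lt_neqAle eq_sym B0 lq_norm_ge0.
rewrite -(ler_pM2l (powR_gt0 (q - 1) Bgt0)) mulrCA [_ `^ _ * _ in leLHS]mulrC.
rewrite mulr_powRB1 ?lq_norm_ge0// lq_norm_powR// mulr_sumr.
apply: le_trans; last first.
  by rewrite mulr_sumr; apply: ler_sum => j _; exact: (lq_norm_dual q c (y j)).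
rewrite exchange_big/=; apply: ler_sum => i _.
rewrite -mulr_sumr -mulr_suml [leLHS]mulrC.
have [->|ci] := eqVneq (c i) 0; first by rewrite powR0 ?gt_eqF// !mul0r.
by rewrite ler_wpM2l ?powR_ge0// ler_pdivlMr// lt_neqAle eq_sym ci c0.
Qed.

(** * The upper and lower estimates for finite sums *)

(* Indices are shifted by one: i < N stands for n = i + 1 >= 1. *)
Definition dyadic_weighted {R : realType} {N : nat} (theta : R) (a : 'I_N -> R)
  (i : 'I_N) : R := (2 ^+ i.+1) `^ theta * `|a i|.

Section WeightedSums.
Context {R : realType} {E0 E1 : normedModType R} (iota : {linear E1 -> E0}).
Context (theta eta q kappa delta : R) (N : nat) (b : nat -> E1).
Context (q1 : 1 <= q) (eta0 : 0 < eta) (kappa0 : 0 < kappa) (delta0 : 0 < delta).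
Context (eta_le : eta <= theta) (eta_le1 : eta <= 1 - theta).
Context (b_le0 : forall i, `|iota (b i)| <= kappa).
Context (b_le1 : forall i, `|b i| <= kappa * 2 ^+ i.+1).
Context (b_ge : forall i, delta <= Kfun iota (2 ^- i.+1) (iota (b i))).

Local Notation weighted := (dyadic_weighted theta).

Lemma Kfun_sum_le_bump (a : 'I_N -> R) (lam : R) : 0 < lam ->
  lam `^ (- theta) * Kfun iota lam (\sum_i a i *: iota (b i)) <=
  4 * kappa * \sum_(i < N) logistic_bump eta (lam * 2 ^+ i.+1) * weighted a i.
Proof.
move=> lam0; apply: le_trans (ler_wpM2l (powR_ge0 _ _) (Kfun_sum _ _ _ _ (ltW lam0))) _.
rewrite !mulr_sumr; apply: ler_sum => i _.
have p0 : 0 < 2 ^+ i.+1 :> R by rewrite exprn_gt0.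
have t0 : 0 < lam * 2 ^+ i.+1 by rewrite mulr_gt0.
rewrite KfunZ ?(ltW lam0)//.
(* The two trivial decompositions, all in [E0] or all in [E1], give the two entries of the
   minimum. *)
have Kb : Kfun iota lam (iota (b i)) <= kappa * Num.min 1 (lam * 2 ^+ i.+1).
  case: (leP 1 (lam * 2 ^+ i.+1)) => _.
    by rewrite mulr1 (le_trans (Kfun_le_norm _ _ _ (ltW lam0))).
  by rewrite (le_trans (Kfun_iota_le _ _ _ (ltW lam0)))// mulrCA ler_wpM2l ?(ltW lam0).
(* This splitting hands the weight (2^(i+1))^theta to the coefficient and leaves a function of [lam]
   * 2^(i+1) alone. *)
have -> : lam `^ (- theta) = (lam * 2 ^+ i.+1) `^ (- theta) * (2 ^+ i.+1) `^ theta.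
  rewrite powRM ?ltW// -mulrA -powRD ?(gt_eqF p0) ?implybT//.
  by rewrite addNr powRr0 mulr1.
have hm := min_powR_le_bump theta eta _ (ltW eta0) eta_le eta_le1 t0.
apply: (@le_trans _ _ (kappa * weighted a i *
  ((lam * 2 ^+ i.+1) `^ (- theta) * Num.min 1 (lam * 2 ^+ i.+1)))).
  rewrite [leRHS](_ : _ = (lam * 2 ^+ i.+1) `^ (- theta) * (2 ^+ i.+1) `^ theta *
    (`|a i| * (kappa * Num.min 1 (lam * 2 ^+ i.+1)))); last by rewrite /dyadic_weighted; ring.
  by rewrite ler_wpM2l ?mulr_ge0 ?powR_ge0// ler_wpM2l.
have w0 : 0 <= kappa * weighted a i by rewrite !mulr_ge0 ?powR_ge0 ?(ltW kappa0).
apply: le_trans (ler_wpM2l w0 hm) _.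
by rewrite le_eqVlt; apply/orP; left; apply/eqP; ring.
Qed.

(** Schur's test. The factor (4 kappa)^q comes from the pointwise bound, the power q - 1 of 2^eta /
    (2^eta - 1) from the total mass of the bumps in [power_mean], and 1/eta from integrating each
    bump. *)
Lemma interp_norm_sum_le (a : 'I_N -> R) :
  (interp_norm iota theta q (\sum_i a i *: iota (b i))%R <=
   (((4 * kappa) `^ q * (2 `^ eta / (2 `^ eta - 1)) `^ (q - 1) / eta) `^ q^-1
     * lq_norm q (weighted a))%:E)%E.
Proof.
set H := 2 `^ eta / (2 `^ eta - 1); set D := (4 * kappa) `^ q * H `^ (q - 1).
set x := \sum_i _.
have q0 : 0 < q by exact: lt_le_trans ltr01 q1.
have c0 i : 0 <= weighted a i by rewrite mulr_ge0 ?powR_ge0.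
have D0 : 0 <= D by rewrite mulr_ge0 ?powR_ge0.
have s0 : 0 <= \sum_i weighted a i `^ q by apply: sumr_ge0 => i _; exact: powR_ge0.
rewrite /lq_norm -powRM ?divr_ge0 ?(ltW eta0)//.
apply: interp_norm_le => //; first by rewrite mulr_ge0 ?divr_ge0 ?(ltW eta0).
pose g (lam : R) := (\sum_(i < N)
  (D * weighted a i `^ q)%:E * (logistic_bump eta (lam * 2 ^+ i.+1) / lam)%:E)%E.
have mb (i : 'I_N) : measurable_fun (`]0, +oo[ : set R)
    (fun lam => (logistic_bump eta (lam * 2 ^+ i.+1) / lam)%:E).
  apply/measurable_EFinP; exact: measurable_fun_bump.
have b0 (i : 'I_N) lam : 0 < lam -> (0 <= (logistic_bump eta (lam * 2 ^+ i.+1) / lam)%:E)%E.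
  by move=> lam0; rewrite lee_fin divr_ge0 ?logistic_bump_ge0 ?ltW.
have Dc0 i : 0 <= D * weighted a i `^ q by rewrite mulr_ge0 ?powR_ge0.
apply: (@le_trans _ _ (\int[lebesgue_measure]_(lam in `]0%R, +oo[) g lam)%E).
  apply: ge0_le_integral => //.
  - move=> lam /=; rewrite in_itv/= andbT => lam0.
    by rewrite lee_fin interp_integrand_ge0.
  - by apply/measurable_EFinP; exact: measurable_interp_integrand.
  - by apply: emeasurable_sum => i; apply: emeasurable_funM; [exact: measurable_cst|exact: mb].
  move=> lam /=; rewrite in_itv/= andbT => lam0.
  rewrite /g; under eq_bigr do rewrite -EFinM.
  rewrite sumEFin lee_fin.
  under eq_bigr do rewrite mulrA.
  rewrite -mulr_suml ler_wpM2r ?invr_ge0 ?(ltW lam0)//.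
  under eq_bigr do rewrite -mulrA.
  rewrite -mulr_sumr.
  have B0 : 0 <= \sum_(i < N) logistic_bump eta (lam * 2 ^+ i.+1).
    by apply: sumr_ge0 => i _; exact: logistic_bump_ge0.
  have S0 : 0 <= \sum_(i < N) logistic_bump eta (lam * 2 ^+ i.+1) * weighted a i.
    by apply: sumr_ge0 => i _; rewrite mulr_ge0 ?logistic_bump_ge0.
  apply: (@le_trans _ _ ((4 * kappa * \sum_(i < N) logistic_bump eta (lam * 2 ^+ i.+1) * weighted a i) `^ q)).
    rewrite ge0_ler_powR ?nnegrE ?(ltW q0) ?Kfun_sum_le_bump//.
      by rewrite mulr_ge0 ?powR_ge0 ?Kfun_ge0 ?ltW.
    by rewrite mulr_ge0 ?mulr_ge0 ?(ltW kappa0).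
  rewrite powRM ?mulr_ge0 ?(ltW kappa0)// /D -mulrA ler_wpM2l ?powR_ge0//.
  apply: le_trans (power_mean _ q _ _ q1 _ c0) _ => [i|]; first exact: logistic_bump_ge0.
  under [in leRHS]eq_bigr do rewrite mulrC.
  rewrite ler_wpM2r//; first by apply: sumr_ge0 => i _; rewrite mulr_ge0 ?logistic_bump_ge0 ?powR_ge0.
  have HB := sum_bump_le eta lam N eta0 lam0.
  by rewrite ge0_ler_powR ?nnegrE ?subr_ge0// (le_trans B0).
rewrite /g ge0_integral_sum//; last 2 first.
- by move=> i; apply: emeasurable_funM; [exact: measurable_cst|exact: mb].
- move=> i lam /=; rewrite in_itv/= andbT => lam0.
  by rewrite mule_ge0 ?b0// lee_fin.
rewrite mulr_sumr -sumEFin; apply: lee_sum => i _.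
rewrite ge0_integralZl_EFin//; last 2 first.
- by move=> lam /=; rewrite in_itv/= andbT; exact: b0.
- exact: mb.
rewrite [leRHS](_ : _ = (D * weighted a i `^ q)%:E * (eta^-1)%:E)%E; last first.
  by rewrite -EFinM mulrAC.
by rewrite lee_wpmul2l ?lee_fin// integral_bump_le// exprn_gt0.
Qed.

(** For each k, [sum_seminorm_signs] applied to the seminorm K(2^-(k+1), .) isolates the k-th term;
    [lq_norm_sum_ge] with w = 2^N delta combines the scales, and the dyadic bound passes to the
    norms. The reals [v e] stand in for norms that are extended reals. *)
Lemma sum_interp_norm_ge (a : 'I_N -> R) (v : {ffun 'I_N -> bool} -> R) :
  (forall e : {ffun 'I_N -> bool}, (interp_norm iota theta q (\sum_i (a i * (-1) ^+ e i) *: iota (b i))%R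
     <= (v e)%:E)%E) ->
  2 `^ (- theta) * 2^-1 `^ q^-1 * delta * lq_norm q (weighted a)
    <= 2 ^- N * \sum_e v e.
Proof.
move=> hv; set C := 2 `^ (- theta) * 2^-1 `^ q^-1.
have theta0 : 0 <= theta by rewrite (le_trans (ltW eta0)).
have C0 : 0 <= C by rewrite mulr_ge0 ?powR_ge0.
pose X (e : {ffun 'I_N -> bool}) := \sum_i (a i * (-1) ^+ e i) *: iota (b i).
pose y (e : {ffun 'I_N -> bool}) (i : 'I_N) := (2 ^+ i.+1) `^ theta * Kfun iota (2 ^- i.+1) (X e).
have V0 (n : nat) : 0 <= 2 ^- n :> R by rewrite invr_ge0 exprn_ge0.
have key : (2 ^+ N * delta) * lq_norm q (weighted a) <= \sum_e lq_norm q (y e).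
  apply: lq_norm_sum_ge => //.
  - by rewrite mulr_ge0 ?exprn_ge0 ?ltW.
  - by move=> i; rewrite mulr_ge0 ?powR_ge0.
  - by move=> e i; rewrite mulr_ge0 ?powR_ge0 ?Kfun_ge0.
  move=> k; rewrite -mulr_sumr /dyadic_weighted mulrCA ler_wpM2l ?powR_ge0//.
  apply: (@le_trans _ _ (2 ^+ N * Kfun iota (2 ^- k.+1) (a k *: iota (b k)))).
    rewrite -mulrA ler_wpM2l ?exprn_ge0// KfunZ// mulrC ler_wpM2l//.
  under eq_bigr => e _.
    rewrite (_ : X e = \sum_i (-1) ^+ e i *: (a i *: iota (b i))); last first.
      by apply: eq_bigr => i _; rewrite scalerA mulrC.
    over.
  apply: (sum_seminorm_signs (Kfun iota (2 ^- k.+1)) N (fun i => a i *: iota (b i))).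
    by move=> *; exact: KfunD.
  by move=> *; exact: KfunZ.
rewrite -mulrA ler_pdivlMl ?exprn_gt0// mulrCA [2 ^+ N * _]mulrA.
apply: le_trans (ler_wpM2l C0 key) _.
rewrite mulr_sumr; apply: ler_sum => e _.
rewrite -lee_fin; apply: le_trans (hv e).
exact: interp_norm_ge_dyadic.
Qed.

End WeightedSums.

(** * Reduction to finite sums and conclusion *)

Lemma finite_nat_bound (A : set nat) : finite_set A ->
  exists N, forall n, A n -> (n <= N)%N.
Proof.
move=> /finite_seqP[s ->]; exists (\max_(i <- s) i) => n /= ns.
exact: leq_bigmax_seq.
Qed.

Lemma fsum_support {R : realType} {V : lmodType R} (alpha : nat -> R) (N : nat)
    (s : nat -> R) (v : nat -> V) :
  (forall n, (0 < n)%N -> alpha n != 0 -> (n <= N)%N) ->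
  \sum_(n \in [set n | (0 < n)%N /\ alpha n != 0]) (alpha n * s n) *: v n =
  \sum_(i < N) (alpha i.+1 * s i.+1) *: v i.+1.
Proof.
move=> hN; rewrite (fsbig_fwiden (index_iota 1 N.+1)).
- by rewrite big_add1/= big_mkord.
- by move=> n /= [n0 an]; rewrite mem_index_iota n0 ltnS hN.
- exact: iota_uniq.
move=> n /= [+ /not_andP[]]; rewrite mem_index_iota => /andP[n0 _] //.
by move=> /negP; rewrite negbK => /eqP ->; rewrite mul0r scale0r.
Qed.

Lemma lq_weighted_normE {R : realType} (theta q : R) (alpha : nat -> R) (N : nat) :
  0 < q -> (forall n, (0 < n)%N -> alpha n != 0 -> (n <= N)%N) ->
  lq_weighted_norm theta q alpha =
  (lq_norm q (dyadic_weighted theta (fun i : 'I_N => alpha i.+1)))%:E.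
Proof.
move=> q0 hN; rewrite /lq_weighted_norm /lq_norm -poweR_EFin; congr poweR.
have -> : (\sum_(1 <= n <oo) (((2 : R) `^ (theta * n%:R) * `|alpha n|) `^ q)%:E
   = \sum_(1 <= n < N.+1) (((2 : R) `^ (theta * n%:R) * `|alpha n|) `^ q)%:E)%E.
  apply/cvg_lim => //; apply: cvg_near_cst; near=> m.
  have Nm : (N.+1 <= m)%N by near: m; exact: nbhs_infty_ge.
  rewrite (@big_cat_nat _ _ _ N.+1)//= [X in (_ + X)%E](_ : _ = 0%E) ?adde0//.
  rewrite big_nat_cond big1// => n /andP[/andP[Nn _] _].
  (* A zero coefficient contributes 0 only because q is nonzero: the power 0^0 is 1. *)
  have [->|an] := eqVneq (alpha n) 0; first by rewrite normr0 mulr0 powR0 ?gt_eqF.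
  by have := hN n (leq_trans (ltn0Sn _) Nn) an; rewrite leqNgt Nn.
rewrite big_add1/= big_mkord sumEFin; congr EFin; apply: eq_bigr => i _.
by rewrite /dyadic_weighted [theta * _]mulrC powRrM powR_mulrn.
Unshelve. all: by end_near. Qed.

Theorem theorem3p1 (R : realType) (theta q kappa delta : R) :
  0 < theta < 1 -> 1 <= q -> 0 < kappa -> 0 < delta ->
  exists c : R, 0 < c /\
  forall (E0 E1 : completeNormedModType R) (iota : {linear E1 -> E0}),
    injective iota -> continuous iota ->
  forall b : nat -> E1,
    (forall n, (0 < n)%N ->
       delta <= Kfun iota (2 `^ (- n%:R)) (iota (b n)) /\
       Kfun iota (2 `^ (- n%:R)) (iota (b n)) <= Jfun iota (2 `^ (- n%:R)) (b n) /\
       Jfun iota (2 `^ (- n%:R)) (b n) <= kappa) ->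
  forall (d : measure_display) (M : measurableType d) (rho : probability M R)
         (eps : nat -> M -> R),
    rademacher_seq rho eps ->
  forall alpha : nat -> R,
    finite_set [set n | (0 < n)%N /\ alpha n != 0] ->
    let S := [set n | (0 < n)%N /\ alpha n != 0] in
    let nrm := lq_weighted_norm theta q alpha in
    [/\ ((c^-1)%:E * nrm <=
           \int[rho]_xi interp_norm iota theta q
              (\sum_(n \in S) (alpha n * eps n xi) *: iota (b n))%R)%E,
        (\int[rho]_xi interp_norm iota theta q
              (\sum_(n \in S) (alpha n * eps n xi) *: iota (b n))%R
         <= ereal_sup [set interp_norm iota theta q
                         (\sum_(n \in S) (alpha n * s n) *: iota (b n))%R
                       | s in [set s : nat -> R |
                                 forall n, (0 < n)%N -> s n = 1%R \/ s n = (-1)%R]])%E &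
        (ereal_sup [set interp_norm iota theta q
                         (\sum_(n \in S) (alpha n * s n) *: iota (b n))%R
                       | s in [set s : nat -> R |
                                 forall n, (0 < n)%N -> s n = 1%R \/ s n = (-1)%R]]
         <= c%:E * nrm)%E].
Proof.
move=> /andP[theta0 theta1] q1 kappa0 delta0.
have q0 : 0 < q by lra.
(* The largest exponent compatible with the decay t^-theta at infinity and t^(1-theta) at zero. *)
pose eta := Num.min theta (1 - theta).
have eta0 : 0 < eta by rewrite lt_min theta0 subr_gt0.
have eta_le : eta <= theta by rewrite ge_min lexx.
have eta_le1 : eta <= 1 - theta by rewrite ge_min lexx orbT.
set C := ((4 * kappa) `^ q * (2 `^ eta / (2 `^ eta - 1)) `^ (q - 1) / eta) `^ q^-1.
set C' := 2 `^ (- theta) * 2^-1 `^ q^-1 * delta.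
have C0 : 0 <= C by exact: powR_ge0.
have C'0 : 0 < C' by rewrite !mulr_gt0 ?powR_gt0.
(* The sum dominates both C, for the upper bound, and 1/C', for the lower one; it is fixed before
   the spaces and the sequences. *)
exists (C + C'^-1); split; first by rewrite ltr_wpDl ?invr_gt0.
move=> E0 E1 iota _ _ b hb d M rho eps rad alpha fin S nrm.
have [N hN] := finite_nat_bound _ fin.
have {}hN n : (0 < n)%N -> alpha n != 0 -> (n <= N)%N by move=> *; exact: hN.
have pow2 n : (2 : R) `^ (- n%:R) = 2 ^- n by rewrite powR_invn.
have b_ge i : delta <= Kfun iota (2 ^- i.+1) (iota (b i.+1)).
  by have [] := hb i.+1 isT; rewrite pow2.
have b_le i : `|iota (b i.+1)| <= kappa /\ `|b i.+1| <= kappa * 2 ^+ i.+1.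
  have [_ [_]] := hb i.+1 isT; rewrite pow2 /Jfun ge_max => /andP[-> le1].
  by split => //; rewrite mulrC -ler_pdivrMl// exprn_gt0.
pose a (i : 'I_N) := alpha i.+1.
have sumE s : \sum_(n \in S) (alpha n * s n) *: iota (b n) =
    \sum_(i < N) (a i * s i.+1) *: iota (b i.+1).
  exact: fsum_support.
have nrmE : nrm = (lq_norm q (dyadic_weighted theta a))%:E.
  exact: lq_weighted_normE.
set L := lq_norm q _ in nrmE.
have L0 : 0 <= L by exact: lq_norm_ge0.
have upper (s : nat -> R) : (forall n, (0 < n)%N -> s n = 1%R \/ s n = (-1)%R) ->
    (interp_norm iota theta q (\sum_(i < N) (a i * s i.+1) *: iota (b i.+1))%R
      <= (C * L)%:E)%E.
  (* Signs do not change the weighted norm, so they can be absorbed into the coefficients. *)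
  move=> s1; have -> : L = lq_norm q (dyadic_weighted theta (fun i => a i * s i.+1)).
    congr lq_norm; apply/funext => i; rewrite /dyadic_weighted normrM.
    by case: (s1 i.+1 isT) => ->; rewrite ?normrN1 ?normr1 mulr1.
  exact: (interp_norm_sum_le iota theta eta q kappa N (fun i => b i.+1) q1 eta0
    kappa0 eta_le eta_le1 (fun i => (b_le i).1) (fun i => (b_le i).2)).
(* A pattern on N indices is extended by 1, so that it competes in the supremum over full sign
   sequences. *)
pose sgn (e : {ffun 'I_N -> bool}) n : R := if insub n.-1 is Some i then (-1) ^+ e i else 1.
have sgnE e (i : 'I_N) : sgn e i.+1 = (-1) ^+ e i.
  by rewrite /sgn /= insubT//= => lt; congr ((-1) ^+ e _); exact: val_inj.
have sgn1 e n : (0 < n)%N -> sgn e n = 1 \/ sgn e n = -1.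
  rewrite /sgn; case: insubP => [i _ _|]; last by left.
  by case: (e i); rewrite ?expr1 ?expr0; [right|left].
pose X (e : {ffun 'I_N -> bool}) := \sum_i (a i * (-1) ^+ e i) *: iota (b i.+1).
have XE e : X e = \sum_(i < N) (a i * sgn e i.+1) *: iota (b i.+1).
  by apply: eq_bigr => i _; rewrite sgnE.
(* Taking [fine] loses nothing: the upper estimate makes each of these norms finite. *)
pose v e := fine (interp_norm iota theta q (X e)).
have vE e : (interp_norm iota theta q (X e) = (v e)%:E)%E.
  rewrite fineK// ge0_fin_numE ?interp_norm_ge0// XE.
  by rewrite (le_lt_trans (upper _ (sgn1 e)))// ltry.
have intE : (\int[rho]_xi interp_norm iota theta q
    (\sum_(n \in S) (alpha n * eps n xi) *: iota (b n))%R = (2 ^- N * \sum_e v e)%R%:E)%E.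
  apply: (rademacher_integral _ _ _ _ _ rad) => [e|e xi he].
    by rewrite fine_ge0// interp_norm_ge0.
  rewrite sumE -vE; congr interp_norm; apply: eq_bigr => i _.
  by rewrite he.
rewrite intE nrmE -!EFinM; set T := ereal_sup _.
have T_le : (T <= (C * L)%:E)%E.
  by apply: ge_ereal_sup => _ [s s1 <-]; rewrite sumE upper.
have v_le e : ((v e)%:E <= T)%E.
  apply: ereal_sup_ubound; exists (sgn e); first exact: sgn1.
  by rewrite sumE -XE vE.
split.
- rewrite lee_fin; apply: le_trans (sum_interp_norm_ge iota theta eta q delta N
    (fun i => b i.+1) q1 eta0 delta0 eta_le b_ge a v _) => [|e].
    rewrite ler_wpM2r// -[leRHS]invrK lef_pV2 ?posrE ?ltr_wpDl ?invr_gt0//.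
    by rewrite lerDr.
  by rewrite vE.
(* The all-plus pattern keeps T above -oo and the upper estimate keeps it below +oo; the mean of 2^N
   values below T is then compared in the reals. *)
- have TE : T = (fine T)%:E.
    rewrite fineK// fin_numElt (lt_le_trans (ltNyr _) (v_le [ffun=> false])).
    exact: le_lt_trans T_le (ltry _).
  rewrite TE lee_fin ler_pdivrMl ?exprn_gt0//.
  rewrite (_ : 2 ^+ N * fine T = \sum_(e : {ffun 'I_N -> bool}) fine T).
    by apply: ler_sum => e _; rewrite -lee_fin -TE.
  by rewrite sumr_const card_ffun card_bool card_ord -[RHS]mulr_natl natrX.
- apply: le_trans T_le _; rewrite lee_fin ler_wpM2r// lerDl.
  by rewrite invr_ge0 ltW.
Qed.
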